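(* Let $n=n_1n_2\ldots n_k|_2$ with $n_i\in\{0,1\}$, and let $w$ be the binary weight of $n$ (the number of $i$ with $n_i=1$). Then $p_2(n)$ is equal to the number of set-covers of a labeled $w$-set by nonempty sets (i.e. the number of collections of distinct nonempty subsets of $\{1,\ldots,w\}$ whose union is $\{1,\ldots,w\}$), that is, $$p_2(n)=\frac12\sum_{i=0}^{w}(-1)^{w-i}\binom{w}{i}2^{2^i}.$$
   Context: $n=n_1n_2\ldots n_k|_2$ denotes the number with binary digits $n_1,\ldots,n_k$. The base $2$ dismal sum $\oplus_2$ of nonnegative integers is the digitwise maximum (bitwise OR) of their binary expansions. $p_2(n)$ is the number of ways of writing $n=m_1\oplus_2 m_2\oplus_2\cdots\oplus_2 m_l$ for some $l\ge1$ and distinct positive integers $m_i$, without regard to the order of summation; $p_2(0)=1$ by convention. *)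

(* Defs.v *)
From HB Require Import structures.
From Stdlib Require Import PeanoNat.
From mathcomp Require Import all_boot all_order all_algebra.
From mathcomp Require Export finmap.

Set Implicit Arguments.
Unset Strict Implicit.
Unset Printing Implicit Defensive.

Local Open Scope nat_scope.
Local Open Scope fset_scope.

(* On base 2 digits, the maximum is the boolean "or", so the base 2 dismal sum
   is the bitwise or of the standard library. *)
Definition dismal_add : nat -> nat -> nat := Nat.lor.

Lemma testbit_dismal_add m n i :
  (Nat.testbit (dismal_add m n) i : nat)
  = maxn (Nat.testbit m i) (Nat.testbit n i).
Proof.
by rewrite /dismal_add Nat.lor_spec; case: Nat.testbit; case: Nat.testbit.
Qed.

Lemma dismal_addA : associative dismal_add.
Proof. by move=> m n p; rewrite /dismal_add Nat.lor_assoc. Qed.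

Lemma dismal_addC : commutative dismal_add.
Proof. by move=> m n; rewrite /dismal_add Nat.lor_comm. Qed.

Lemma dismal_add0 : left_id 0 dismal_add.
Proof. by move=> n; rewrite /dismal_add Nat.lor_0_l. Qed.

HB.instance Definition _ :=
  Monoid.isComLaw.Build nat 0 dismal_add dismal_addA dismal_addC dismal_add0.

(* A set of distinct positive integers m_1, ..., m_l with l >= 1 and
   dismal sum n. *)
Definition dismal_partition (n : nat) (A : {fset nat}) : bool :=
  [&& A != fset0, 0 \notin A & \big[dismal_add/0]_(m <- A) m == n].

(* The restriction to parts m <= n only serves to make the family finite: it
   excludes nothing, by mem_dismal_partitions. *)
Definition dismal_partitions (n : nat) : {fset {fset nat}} :=
  [fset A in fpowerset [fset m in iota 1 n] | dismal_partition n A].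

Lemma leq_dismal_addl m n : m <= dismal_add m n.
Proof.
have /Nat.ldiff_le /leP // : Nat.ldiff m (dismal_add m n) = 0.
apply: Nat.bits_inj => i; rewrite Nat.ldiff_spec Nat.lor_spec Nat.bits_0.
by case: Nat.testbit; case: Nat.testbit.
Qed.

Lemma mem_dismal_partitions (n : nat) (A : {fset nat}) :
  (A \in dismal_partitions n) = dismal_partition n A.
Proof.
rewrite !inE /=; apply: andb_idl => /and3P[_ A0 /eqP <-].
rewrite fpowersetE; apply/fsubsetP => m mA.
rewrite !inE /= mem_iota add1n ltnS lt0n (memPn A0) //=.
by rewrite (big_rem m) //= leq_dismal_addl.
Qed.

Definition p2 (n : nat) : nat := if n == 0 then 1 else #|` dismal_partitions n|.

(* The leading digit is d_0, and is allowed to be 0. *)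
Definition binary_value (k : nat) (d : k.-tuple bool) : nat :=
  \sum_(i < k) tnth d i * 2 ^ (k - i.+1).

Definition binary_weight (k : nat) (d : k.-tuple bool) : nat :=
  #|[set i : 'I_k | tnth d i]|.

Definition set_covers (w : nat) : {set {set {set 'I_w}}} :=
  [set F : {set {set 'I_w}} | (set0 \notin F) && (cover F == [set: 'I_w])].

(* Main.v *)
Require Import Defs.
From Stdlib Require Import PeanoNat.
From mathcomp Require Import all_boot all_order all_algebra.

(** Let [S] be the set of positions where [n] has a digit 1, so that [#|S| = w].
A number [m] can occur in a dismal sum equal to [n] only if its binary ones lie
at positions of [S], and the numbers with this property are in bijection with
the subsets of [S]: a subset corresponds to the sum of the powers of 2 at its
positions ([bits]).  This bijection sends the empty set to 0, [S] to [n], and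
unions to dismal sums.  Hence a set of distinct positive numbers with dismal
sum [n] is the same thing as a set of nonempty subsets of [S] with union [S]
([card_dismal_partitions]).  Only [n = 0] needs care: there the empty family
is a cover, whereas a dismal sum must have a summand, so that [p2 0 = 1] holds
by convention.

The number of covers follows by inclusion-exclusion on the union of a family.
The alternating sum of signs over the supersets [A] of a set [C] detects
whether [C] is the full set ([sum_signs_supersets]).  Taking for [C] the union
of a family of nonempty sets, summing over all such families and exchanging the
sums leaves, for each [A], the number of families of nonempty subsets of [A],
which is [2 ^ (2 ^ #|A| - 1)]; this is where the factor one half comes from.
Grouping the sets [A] by cardinality gives the formula ([card_set_covers]). *)

Set Implicit Arguments.
Unset Strict Implicit.
Unset Printing Implicit Defensive.

Import GRing.Theory.

Local Open Scope nat_scope.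

Lemma testbit_big_dismal_add (I : Type) (r : seq I) (P : pred I)
    (F : I -> nat) (j : nat) :
  Nat.testbit (\big[dismal_add/0]_(i <- r | P i) F i) j
  = has (fun i => P i && Nat.testbit (F i) j) r.
Proof.
elim: r => [|i r IHr]; first by rewrite big_nil Nat.bits_0.
rewrite big_cons /=; case: (P i) => //=.
by rewrite [LHS]Nat.lor_spec IHr.
Qed.

Lemma testbit_exp2 (i j : nat) : Nat.testbit (2 ^ i) j = (i == j).
Proof.
have -> : 2 ^ i = Nat.pow 2 i by elim: i => // i IHi; rewrite expnS IHi.
by rewrite Nat.pow2_bits_eqb; apply/Nat.eqb_spec/eqP.
Qed.

Section Bits.

Variables (T : finType) (e : T -> nat) (e_inj : injective e).

(** A dismal sum rather than an ordinary one: its binary digits are then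
immediate, and the two sums agree because the powers are distinct, as
[bits_setT] shows for the full set. *)
Definition bits (X : {set T}) : nat := \big[dismal_add/0]_(i in X) 2 ^ e i.

Definition parts (F : {set {set T}}) : {fset nat} := [fset bits X | X in F]%fset.

Lemma testbit_bitsP (X : {set T}) (j : nat) :
  reflect (exists2 i, i \in X & e i = j) (Nat.testbit (bits X) j).
Proof.
rewrite testbit_big_dismal_add.
apply: (iffP hasP) => [[i _ /andP[iX]] | [i iX <-]].
  by rewrite testbit_exp2 => /eqP; exists i.
by exists i; rewrite ?mem_index_enum // iX testbit_exp2 eqxx.
Qed.

Lemma testbit_bits (X : {set T}) (i : T) :
  Nat.testbit (bits X) (e i) = (i \in X).
Proof. by apply/testbit_bitsP/idP=> [[x xX /e_inj <-] //|]; exists i. Qed.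

Lemma bits_inj : injective bits.
Proof. by move=> X Y eqXY; apply/setP=> i; rewrite -!testbit_bits eqXY. Qed.

Lemma bits_eq0 (X : {set T}) : (bits X == 0) = (X == set0).
Proof. by rewrite -(inj_eq bits_inj) [bits set0]big_set0. Qed.

(** Since [e] is injective, no carry occurs in the addition. *)
Lemma bits_setT : bits [set: T] = \sum_(i : T) 2 ^ e i.
Proof.
rewrite /bits (eq_bigl predT) => [|i]; last by rewrite inE.
have := index_enum_uniq T.
elim: (index_enum T) => [|i r IHr] /=; first by rewrite !big_nil.
case/andP=> ir /IHr IH; rewrite !big_cons -IH.
set m := 2 ^ e i; set s := \big[_/_]_(_ <- r) _.
suff disjoint_bits : Nat.land m s = 0.
  by rewrite /dismal_add -Nat.lxor_lor // -Nat.add_nocarry_lxor.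
apply: Nat.bits_inj => j.
rewrite Nat.land_spec Nat.bits_0 testbit_exp2 testbit_big_dismal_add.
case: eqP => //= <-; apply/hasPn => x xr; rewrite testbit_exp2 (inj_eq e_inj).
by apply: contraNN ir => /eqP <-.
Qed.

(** The hypothesis says that every binary one of [m] is one of [bits X], hence
sits at a position in the image of [e]. *)
Lemma bits_of_submask (X : {set T}) (m : nat) :
  dismal_add m (bits X) = bits X ->
  m = bits [set i | Nat.testbit m (e i)].
Proof.
move=> mX; apply: Nat.bits_inj => j.
apply/idP/testbit_bitsP => [mj | [i]]; last by rewrite inE => im <-.
have /testbit_bitsP[i _ ij] : Nat.testbit (bits X) j.
  by rewrite -mX Nat.lor_spec mj.
by exists i; rewrite // inE ij.
Qed.

Lemma parts_inj : injective parts.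
Proof.
move=> F G eqFG; apply/setP=> X.
have mem_parts (H : {set {set T}}) : (X \in H) = (bits X \in parts H).
  by apply/idP/imfsetP => [XH | [Y YH /bits_inj ->] //]; exists X.
by rewrite !mem_parts eqFG.
Qed.

(** Both sides have a binary one exactly at the positions [e i] with [i] in some
member of [F]. *)
Lemma big_dismal_add_parts (F : {set {set T}}) :
  \big[dismal_add/0]_(m <- parts F) m = bits (cover F).
Proof.
apply: Nat.bits_inj => j; rewrite testbit_big_dismal_add.
apply/hasP/testbit_bitsP => [[_ /imfsetP[X /= XF ->]] | [i iF ij]].
  by case/testbit_bitsP => i iX ij; exists i => //; apply/bigcupP; exists X.
have /bigcupP[X XF iX] := iF.
exists (bits X); first by apply/imfsetP; exists X.
by apply/testbit_bitsP; exists i.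
Qed.

(** Nonemptiness of [T] excludes the empty family, which covers only the empty
set but never gives a dismal partition. *)
Lemma dismal_partition_parts (F : {set {set T}}) : [set: T] != set0 ->
  dismal_partition (bits [set: T]) (parts F)
  = (set0 \notin F) && (cover F == [set: T]).
Proof.
move=> T_neq0; rewrite /dismal_partition big_dismal_add_parts (inj_eq bits_inj).
have -> : (0 \in parts F) = (set0 \in F).
  apply/imfsetP/idP => [[X /= XF /esym/eqP] | F0].
    by rewrite bits_eq0 => /eqP <-.
  by exists set0; rewrite //= [RHS]big_set0.
apply: andb_idl => /andP[_ /eqP covF]; apply: contra_neqN T_neq0 => /eqP F0.
rewrite -covF; apply/eqP; rewrite -subset0; apply/bigcupsP=> X XF.
suff: bits X \in parts F by rewrite F0 in_fset0.
by apply/imfsetP; exists X.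
Qed.

(** Surjectivity of [parts] onto the dismal partitions: a summand is absorbed by
the total, because the bitwise or is idempotent, so it is of the form [bits]. *)
Lemma parts_of_dismal_partition (A : {fset nat}) :
  dismal_partition (bits [set: T]) A ->
  A = parts [set X | bits X \in A].
Proof.
case/and3P=> _ _ /eqP sumA; apply/fsetP=> m.
apply/idP/imfsetP => [mA | [X /=]]; last by rewrite inE => XA ->.
suff mT : dismal_add m (bits [set: T]) = bits [set: T].
  exists [set i | Nat.testbit m (e i)]; rewrite /= ?inE;
    by rewrite -(bits_of_submask mT).
by rewrite -sumA (big_rem m mA) /= dismal_addA /dismal_add Nat.lor_diag.
Qed.

Lemma card_dismal_partitions : [set: T] != set0 ->
  #|` dismal_partitions (bits [set: T])|
  = #|[set F : {set {set T}} | (set0 \notin F) && (cover F == [set: T])]|.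
Proof.
move=> T_neq0; set covers := [set F | _].
have -> : dismal_partitions (bits [set: T]) = [fset parts F | F in covers]%fset.
  apply/fsetP=> A; rewrite mem_dismal_partitions.
  apply/idP/imfsetP => [partA | [F /= Fcov ->]].
    exists [set X | bits X \in A] => /=;
      last exact: parts_of_dismal_partition.
    by rewrite inE -dismal_partition_parts // -parts_of_dismal_partition.
  by rewrite dismal_partition_parts //; rewrite inE in Fcov.
rewrite card_imfset; last exact: parts_inj.
by rewrite -cardE.
Qed.

End Bits.

Local Open Scope ring_scope.

(** Expand the product over [x] of [1 - (x \notin C)]: choosing 1 at the elements
of [A] and the other term elsewhere contributes the sign of the complement of
[A] when [C \subset A], and 0 otherwise. *)
Lemma sum_signs_supersets (R : comPzRingType) (T : finType) (C : {set T}) :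
  \sum_(A : {set T} | C \subset A) (-1) ^+ (#|T| - #|A|)
  = (C == [set: T])%:R :> R.
Proof.
have -> : (C == [set: T])%:R = \prod_(x : T) (1 + - (x \notin C)%:R) :> R.
  have [->|CT] := eqVneq C [set: T].
    by rewrite big1 // => x _; rewrite inE subr0.
  have /subsetPn[x _ xC] : ~~ ([set: T] \subset C) by rewrite subTset.
  by rewrite (bigD1 x) //= xC subrr mul0r.
rewrite bigA_distr big_mkcond; apply: eq_bigr => A _.
have [CA|] := boolP (C \subset A).
  have <- : #|~: A| = (#|T| - #|A|)%N by rewrite cardsCs setCK.
  rewrite -prodr_const [LHS]big_mkcond; apply: eq_bigr => x _.
  rewrite inE; case: (boolP (x \in A)) => //= xA.
  by rewrite (contra (subsetP CA x)).
case/subsetPn=> x xC xA.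
by rewrite (bigD1 x) //= (negPf xA) xC oppr0 mul0r.
Qed.

(** These families are the subsets of [powerset A :\ set0]. *)
Lemma card_families_within (T : finType) (A : {set T}) :
  #|[set F : {set {set T}} | (set0 \notin F) && (cover F \subset A)]|
  = (2 ^ (2 ^ #|A|).-1)%N.
Proof.
have <- : #|powerset A :\ set0| = (2 ^ #|A|).-1.
  by rewrite -card_powerset [in RHS](cardsD1 set0) powersetE sub0set.
rewrite -card_powerset; apply: eq_card => F; rewrite !inE subsetD1 andbC.
congr (_ && _); apply/bigcupsP/subsetP => sFA X /sFA; by rewrite powersetE.
Qed.

Lemma card_set_covers (w : nat) :
  (#|set_covers w|)%:R =
    2^-1 * \sum_(i < w.+1) (-1) ^+ (w - i) * ('C(w, i))%:R * 2 ^+ (2 ^ i) :> rat.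
Proof.
have -> : #|set_covers w|%:R = \sum_(A : {set 'I_w})
    (-1) ^+ (w - #|A|) * (2 ^ (2 ^ #|A|).-1)%:R :> rat.
  rewrite -sum1_card natr_sum (eq_bigl _ _ (in_set _)) big_mkcondr /=.
  under eq_bigr => F _.
    rewrite (_ : (if _ then _ else _) = (cover F == [set: 'I_w])%:R);
      last by case: eqP.
    rewrite -sum_signs_supersets card_ord; over.
  rewrite (exchange_big_dep predT) //=; apply: eq_bigr => A _.
  by rewrite sumr_const -card_families_within mulr_natr cardsE.
rewrite mulr_sumr.
have card_lt (A : {set 'I_w}) : (#|A| < w.+1)%N.
  by rewrite ltnS -[w in (_ <= w)%N]card_ord max_card.
rewrite (partition_big (fun A => Ordinal (card_lt A)) predT) //=.
apply: eq_bigr => i _.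
have half : (2 ^ (2 ^ i).-1)%:R = 2^-1 * 2 ^+ (2 ^ i) :> rat.
  by rewrite -[in RHS](prednK (expn_gt0 2 i)) exprS mulKf // natrX.
rewrite (eq_bigr (fun=> (-1) ^+ (w - i) * (2 ^ (2 ^ i).-1)%:R)); last first.
  by move=> A /eqP <-.
have -> : 'C(w, i) = #|[pred A : {set 'I_w} | Ordinal (card_lt A) == i]|.
  by rewrite -[w in 'C(w, _)]card_ord -card_draws cardsE; apply: eq_card.
by rewrite sumr_const half -[LHS]mulr_natr [RHS]mulrCA mulrAC.
Qed.

Theorem theorem22 (k : nat) (d : k.-tuple bool) (n w : nat)
    (n_digits : n = binary_value d) (w_weight : w = binary_weight d) :
  p2 n = #|set_covers w| /\
  (p2 n)%:R =
    2^-1 * \sum_(i < w.+1) (-1) ^+ (w - i) * ('C(w, i))%:R * 2 ^+ (2 ^ i) :> rat.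
Proof.
suff p2_covers : p2 n = #|set_covers w|.
  by rewrite p2_covers; split=> //; apply: card_set_covers.
rewrite {n}n_digits {w}w_weight /binary_weight; set S := [set i | _].
(* The digit of index [i] counted from the leading one has weight
   [2 ^ (k - i.+1)]. *)
pose e (x : 'I_#|S|) := (k - (enum_val x).+1)%N.
have e_inj : injective e.
  by move=> x y /eqP; rewrite eqn_sub2lE // => /eqP[/val_inj/enum_val_inj].
have -> : binary_value d = bits e [set: 'I_#|S|].
  rewrite bits_setT // -(big_enum_val (fun i : 'I_k => 2 ^ (k - i.+1)))%N /=.
  rewrite [RHS]big_mkcond; apply: eq_bigr => i _.
  by rewrite inE; case: (tnth d i); rewrite ?mul1n ?mul0n.
rewrite /p2 bits_eq0 //; have [T0|T_neq0] := eqVneq; last first.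
  exact: card_dismal_partitions.
(* Here [n = 0]: the empty family is the only cover, since its members would be
   nonempty subsets of the empty set. *)
suff -> : set_covers #|S| = [set set0] by rewrite cards1.
apply/setP=> F; rewrite !inE; apply/andP/eqP => [[F0 _] | ->].
  apply/eqP; rewrite -subset0; apply/subsetP=> X XF.
  have /eqP X0 : X == set0 by rewrite -subset0 -T0 subsetT.
  by rewrite -X0 XF in F0.
by rewrite inE /cover big_set0 T0.
Qed.
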